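(* Let $q\in\mathbb F$ with $q\neq 0,\pm1$. (1) Suppose $(A,\succ,\prec)$ is a dendriform algebra satisfying, for all $x,y,z\in A$, $$x\succ(y\succ z)=(x\prec y)\prec z,\qquad (x\prec y)\succ z=x\prec(y\succ z),$$ $$(q^2+3q+2)(x\prec y)\prec z+(q^2+2q)\,x\succ(y\prec z)+(q^2-q)\,x\prec(y\prec z)=0.$$ Then its associated pre-Lie algebra $(A,\ast)$, given by $x\ast y=x\succ y-y\prec x$, satisfies, for all $x,y,z\in A$ and with $[x,y]=x\ast y-y\ast x$, $$(2+q)[x,y]\ast z+(-q^2-2q)\,z\ast[x,y]+(q^2-q)\big((z\ast y)\ast x-(z\ast x)\ast y\big)=0.$$ In particular (case $q=-2$), the associated pre-Lie algebra of a Novikov-type dendriform algebra is a Novikov algebra. (2) Suppose $(A,\vartriangleright,\vartriangleleft)$ is an anti-dendriform algebra satisfying, for all $x,y,z\in A$, $$(x\vartriangleleft y)\vartriangleright z=x\vartriangleleft(y\vartriangleright z),$$ $$(-q^2+q+2)(x\vartriangleleft y)\vartriangleleft z-q^2(x\vartriangleright y)\vartriangleleft z+(q^2+q)\,x\vartriangleleft(y\vartriangleleft z)=0.$$ Then its associated anti-pre-Lie algebra $(A,\circ)$, given by $x\circ y=x\vartriangleright y-y\vartriangleleft x$, satisfies, for all $x,y,z\in A$ and with $[x,y]_\circ=x\circ y-y\circ x$, $$(2+q)[x,y]_\circ\circ z-q^2\,z\circ[x,y]_\circ+(q^2+q)\big((z\circ x)\circ y-(z\circ y)\circ x\big)=0.$$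 In particular (case $q=-2$), the associated anti-pre-Lie algebra of an admissible Novikov-type dendriform algebra is an admissible Novikov algebra.
   Context: All vector spaces are finite-dimensional over a field $\mathbb F$ of characteristic $0$. Dendriform algebra: a vector space $A$ with two bilinear operations $\succ,\prec$ such that, with $x\cdot y=x\succ y+x\prec y$, for all $x,y,z\in A$, $$x\succ(y\succ z)=(x\cdot y)\succ z,\qquad (x\prec y)\prec z=x\prec(y\cdot z),\qquad (x\succ y)\prec z=x\succ(y\prec z).$$ It is known that then $x\ast y=x\succ y-y\prec x$ defines a pre-Lie algebra, called the associated pre-Lie algebra. Novikov-type dendriform algebra: a dendriform algebra with, for all $x,y,z\in A$, $x\succ(y\succ z)=(x\prec y)\prec z$, $(x\prec y)\succ z=x\prec(y\succ z)$ and $x\prec(y\prec z)=0$. Anti-dendriform algebra: a vector space $A$ with two bilinear operations $\vartriangleright,\vartriangleleft$ such that, with $x\cdot y=x\vartriangleright y+x\vartriangleleft y$, for all $x,y,z\in A$, $$x\vartriangleright(y\vartriangleright z)=-(x\cdot y)\vartriangleright z=-x\vartriangleleft(y\cdot z)=(x\vartriangleleft y)\vartriangleleft z,\qquad (x\vartriangleright y)\vartriangleleft z=x\vartriangleright(y\vartriangleleft z).$$ Then $x\circ y=x\vartriangleright y-y\vartriangleleft x$ defines an anti-pre-Lie algebra, called the associated anti-pre-Lie algebra. Admissible Novikov-type dendriform algebra: an anti-dendriform algebra with, for all $x,y,z\in A$, $(x\vartriangleleft y)\vartriangleright z=x\vartriangleleft(y\vartriangleright z)$ and $x\vartriangleleft(y\vartriangleleft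 z)=2(x\cdot y)\vartriangleleft z$, where $x\cdot y=x\vartriangleright y+x\vartriangleleft y$. Pre-Lie algebra: a vector space with a bilinear operation $\ast$ such that $(x\ast y)\ast z-x\ast(y\ast z)=(y\ast x)\ast z-y\ast(x\ast z)$ for all $x,y,z$. Novikov algebra: a pre-Lie algebra with $(x\ast y)\ast z=(x\ast z)\ast y$ for all $x,y,z$. Anti-pre-Lie algebra: a vector space with a bilinear operation $\circ$ such that, with $[x,y]_\circ=x\circ y-y\circ x$, for all $x,y,z$: $x\circ(y\circ z)-y\circ(x\circ z)=[y,x]_\circ\circ z$ and $[x,y]_\circ\circ z+[y,z]_\circ\circ x+[z,x]_\circ\circ y=0$. Admissible Novikov algebra: a vector space with a bilinear operation $\circ$ such that, for all $x,y,z$: $x\circ(y\circ z)-y\circ(x\circ z)=[y,x]_\circ\circ z$ and $2x\circ[y,z]_\circ=(x\circ y)\circ z-(x\circ z)\circ y$. *)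

(* Defs.v *)
From HB Require Import structures.
From mathcomp Require Import all_boot all_order all_algebra.

Set Implicit Arguments.
Unset Strict Implicit.
Unset Printing Implicit Defensive.

Import GRing.Theory.
Local Open Scope ring_scope.

Section Algebras.

Variables (F : fieldType) (A : vectType F).

Definition is_bilinear (op : A -> A -> A) : Prop :=
  bilinear_for *:%R *:%R op.

Definition commutator (op : A -> A -> A) (x y : A) : A := op x y - op y x.

Definition sum_op (r l : A -> A -> A) (x y : A) : A := r x y + l x y.

(* The product of the associated pre-Lie algebra when r, l are the dendriform
   operations, and of the associated anti-pre-Lie algebra when they are the
   anti-dendriform ones; note the swapped arguments of l. *)
Definition assoc_op (r l : A -> A -> A) (x y : A) : A := r x y - l y x.

Record dendriform (succ prec : A -> A -> A) : Prop := Dendriform {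
  dend_bilinear_succ : is_bilinear succ;
  dend_bilinear_prec : is_bilinear prec;
  dend_succ_succ : forall x y z,
    succ x (succ y z) = succ (sum_op succ prec x y) z;
  dend_prec_prec : forall x y z,
    prec (prec x y) z = prec x (sum_op succ prec y z);
  dend_succ_prec : forall x y z, prec (succ x y) z = succ x (prec y z)
}.

Record novikov_dendriform (succ prec : A -> A -> A) : Prop :=
  NovikovDendriform {
  novd_dendriform : dendriform succ prec;
  novd_succ_succ : forall x y z, succ x (succ y z) = prec (prec x y) z;
  novd_prec_succ : forall x y z, succ (prec x y) z = prec x (succ y z);
  novd_prec_prec : forall x y z, prec x (prec y z) = 0
}.

(* tr and tl are the operations written with right- and left-pointing
   triangles. *)
Record anti_dendriform (tr tl : A -> A -> A) : Prop := AntiDendriform {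
  adend_bilinear_tr : is_bilinear tr;
  adend_bilinear_tl : is_bilinear tl;
  adend_tr_tr : forall x y z, tr x (tr y z) = - tr (sum_op tr tl x y) z;
  adend_tr_tl : forall x y z,
    - tr (sum_op tr tl x y) z = - tl x (sum_op tr tl y z);
  adend_tl_tl : forall x y z, - tl x (sum_op tr tl y z) = tl (tl x y) z;
  adend_assoc : forall x y z, tl (tr x y) z = tr x (tl y z)
}.

Record admissible_novikov_dendriform (tr tl : A -> A -> A) : Prop :=
  AdmissibleNovikovDendriform {
  anovd_anti_dendriform : anti_dendriform tr tl;
  anovd_tl_tr : forall x y z, tr (tl x y) z = tl x (tr y z);
  anovd_tl_tl : forall x y z,
    tl x (tl y z) = 2%:R *: tl (sum_op tr tl x y) z
}.

Record pre_lie (op : A -> A -> A) : Prop := PreLie {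
  prelie_bilinear : is_bilinear op;
  prelie_left_symmetric : forall x y z,
    op (op x y) z - op x (op y z) = op (op y x) z - op y (op x z)
}.

Record novikov (op : A -> A -> A) : Prop := Novikov {
  novikov_pre_lie : pre_lie op;
  novikov_right_commutative : forall x y z, op (op x y) z = op (op x z) y
}.

Record anti_pre_lie (op : A -> A -> A) : Prop := AntiPreLie {
  aprelie_bilinear : is_bilinear op;
  aprelie_op : forall x y z,
    op x (op y z) - op y (op x z) = op (commutator op y x) z;
  aprelie_cyclic : forall x y z,
    op (commutator op x y) z + op (commutator op y z) x
      + op (commutator op z x) y = 0
}.

Record admissible_novikov (op : A -> A -> A) : Prop := AdmissibleNovikov {
  anovikov_bilinear : is_bilinear op;
  anovikov_op : forall x y z,
    op x (op y z) - op y (op x z) = op (commutator op y x) z;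
  anovikov_commutator : forall x y z,
    2%:R *: op x (commutator op y z) = op (op x y) z - op (op x z) y
}.

End Algebras.

(* Main.v *)
Require Import Defs.
From mathcomp Require Import all_boot all_order all_algebra.
From mathcomp Require Import ring.

Set Implicit Arguments.
Unset Strict Implicit.
Unset Printing Implicit Defensive.

Import GRing.Theory VectorInternalTheory.
Local Open Scope ring_scope.

(** Write [r] and [l] for the two operations, [x y] for their sum, and
    [x * y = r x y - l y x] for the associated product.  Dendriform and
    anti-dendriform algebras obey the same axioms up to a sign [e], with
    [e = 1] and [e = -1] respectively:
      [r x (r y z) = e r (x y) z],  [l (l x y) z = e l x (y z)]  and
      [l (r x y) z = r x (l y z)].
    Both halves of the theorem are therefore instances of one computation.
    These three axioms alone give
      [x * (y * z) - y * (x * z) = e [x, y] * z]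
    ([assoc_op_left_symmetric]), which is left symmetry for [e = 1] and the
    first anti-pre-Lie identity for [e = -1].

    Suppose moreover that [r x (r y z) = l (l x y) z], which is an axiom of
    anti-dendriform algebras, and [r (l x y) z = l x (r y z)].  The first
    of these equates [r (x y) z] with [l x (y z)]; removing the inner terms,
    equal by the second, leaves [r (r x y) z = l x (l y z)].  So every product of three elements is a
    combination of
      [B x y z = l (l x y) z],  [M x y z = l (r x y) z]  and
      [C x y z = l x (l y z)].
    For a trilinear [f] let
      [D f = f x y z - f y x z - f z x y + f z y x].
    The commutator of [*] is that of the sum of [r] and [l], and expanding
    yields
      [[x, y] * z = e D B],  [z * [x, y] = - D B - D M]  and
      [(z * y) * x - (z * x) * y = D C]
    (lemmas [assoc_op_commutatorl], [assoc_op_commutatorr] and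
    [assoc_op_right_defect]).  Hence a relation
      [(e a - b) B - b M + c C = 0]
    forces
      [a [x, y] * z + b z * [x, y] + c ((z * y) * x - (z * x) * y) = 0],
    which is [assoc_op_identity].  The two families in [q] correspond to
    [(a, b, c) = (2 + q, - q^2 - 2 q, q^2 - q)] and
    [(a, b, c) = (2 + q, - q^2, - q^2 - q)]; the Novikov and admissible Novikov
    identities are the cases [(0, 0, 1)] and [(0, 2, 1)], which are the cases
    [q = -2] after division by [6] and by [-2]. *)

(** * Identities between vectors *)

Section Coordinates.

Variables (F : fieldType) (A : vectType F).
Implicit Types u v : A.

Lemma v2r_coordD u v i : v2r (u + v) 0 i = v2r u 0 i + v2r v 0 i.
Proof. by rewrite linearD mxE. Qed.

Lemma v2r_coordN u i : v2r (- u) 0 i = - v2r u 0 i.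
Proof. by rewrite linearN mxE. Qed.

Lemma v2r_coordZ a u i : v2r (a *: u) 0 i = a * v2r u 0 i.
Proof. by rewrite linearZ mxE. Qed.

Lemma v2r_coord0 i : v2r (0 : A) 0 i = 0.
Proof. by rewrite linear0 mxE. Qed.

Definition v2r_coordE := (v2r_coordD, v2r_coordN, v2r_coordZ, v2r_coord0).

End Coordinates.

(** An equality between linear combinations of vectors holds as soon as it does
    in coordinates, where it is an identity in a commutative ring. *)
Ltac vector_ring :=
  apply: v2r_inj; apply/rowP => ?; rewrite ?v2r_coordE; ring.

(** * Bilinear operations *)

Section Bilinear.

Variables (F : fieldType) (A : vectType F) (op : A -> A -> A).
Hypothesis op_bilinear : is_bilinear op.

Lemma bilinearPl a u v w : op (a *: u + v) w = a *: op u w + op v w.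
Proof. exact: (op_bilinear.1 w a u v). Qed.

Lemma bilinearPr a u v w : op w (a *: u + v) = a *: op w u + op w v.
Proof. exact: (op_bilinear.2 w a u v). Qed.

Lemma bilinearDl u v w : op (u + v) w = op u w + op v w.
Proof. by rewrite -[u]scale1r bilinearPl !scale1r. Qed.

Lemma bilinearDr u v w : op w (u + v) = op w u + op w v.
Proof. by rewrite -[u]scale1r bilinearPr !scale1r. Qed.

Lemma bilinearNl u w : op (- u) w = - op u w.
Proof.
(* Writing [- u] over [u] itself avoids a separate treatment of [op 0 w]. *)
have -> : - u = (- 2%:R) *: u + u by vector_ring.
rewrite bilinearPl; vector_ring.
Qed.

Lemma bilinearNr u w : op w (- u) = - op w u.
Proof.
have -> : - u = (- 2%:R) *: u + u by vector_ring.
rewrite bilinearPr; vector_ring.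
Qed.

Definition bilinearE := (bilinearDl, bilinearDr, bilinearNl, bilinearNr).

End Bilinear.

(** * Dendriform axioms up to a sign *)

(** The value [e = 1] gives dendriform algebras; [e = -1] gives the part of the
    anti-dendriform axioms that does not relate [r x (r y z)] to
    [l (l x y) z]. *)
Record signed_dendriform (F : fieldType) (A : vectType F) (e : F)
    (r l : A -> A -> A) : Prop := SignedDendriform {
  sdend_bilinear_r : is_bilinear r;
  sdend_bilinear_l : is_bilinear l;
  sdend_rr : forall x y z, r x (r y z) = e *: r (sum_op r l x y) z;
  sdend_ll : forall x y z, l (l x y) z = e *: l x (sum_op r l y z);
  sdend_lr : forall x y z, l (r x y) z = r x (l y z)
}.

Section AssociatedProduct.

Variables (F : fieldType) (A : vectType F) (e : F) (r l : A -> A -> A).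
Hypothesis rl_dendriform : signed_dendriform e r l.

Let r_bilinear := sdend_bilinear_r rl_dendriform.
Let l_bilinear := sdend_bilinear_l rl_dendriform.
Let rE := bilinearE r_bilinear.
Let lE := bilinearE l_bilinear.
Let rr := sdend_rr rl_dendriform.
Let ll := sdend_ll rl_dendriform.
Let lr := sdend_lr rl_dendriform.

Local Notation "x ** y" := (assoc_op r l x y) (at level 40, left associativity).
Local Notation "[ x , y ]" := (commutator (assoc_op r l) x y).

Lemma assoc_op_bilinear : is_bilinear (assoc_op r l).
Proof.
split=> w a u v; rewrite /= /assoc_op.
  rewrite (bilinearPl r_bilinear) (bilinearPr l_bilinear); vector_ring.
rewrite (bilinearPr r_bilinear) (bilinearPl l_bilinear); vector_ring.
Qed.

Lemma commutator_assoc_op x y : [x, y] = sum_op r l x y - sum_op r l y x.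
Proof. rewrite /commutator /assoc_op /sum_op; vector_ring. Qed.

(** In the skew-symmetrization in [x] and [y] the four mixed terms
    [r x (l z y)], [l (r y z) x] cancel by [l (r x y) z = r x (l y z)], and
    the others are paired off by the two sign axioms. *)
Lemma assoc_op_left_symmetric x y z :
  x ** (y ** z) - y ** (x ** z) = e *: ([x, y] ** z).
Proof.
have -> : x ** (y ** z) - y ** (x ** z)
    = (r x (r y z) - r y (r x z)) + (l (l z y) x - l (l z x) y).
  rewrite /assoc_op !rE !lE !lr; vector_ring.
rewrite commutator_assoc_op /assoc_op !rr !ll.
rewrite (bilinearDl r_bilinear (sum_op r l x y)) (bilinearNl r_bilinear).
rewrite (bilinearDr l_bilinear (sum_op r l x y)) (bilinearNr l_bilinear).
vector_ring.
Qed.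

Hypothesis e_sign : e ^+ 2 = 1.
Hypothesis rr_ll : forall x y z, r x (r y z) = l (l x y) z.

(** Since [e ^+ 2 = 1], both [r (x y) z] and [l x (y z)] are
    [e *: l (l x y) z], where [x y] is the sum of the two operations. *)
Lemma assoc_op_commutatorl x y z :
  [x, y] ** z
  = e *: (l (l x y) z - l (l y x) z - l (l z x) y + l (l z y) x).
Proof.
have r_sum u v w : r (sum_op r l u v) w = e *: l (l u v) w.
  by rewrite -rr_ll rr scalerA -expr2 e_sign scale1r.
have l_sum u v w : l u (sum_op r l v w) = e *: l (l u v) w.
  by rewrite ll scalerA -expr2 e_sign scale1r.
rewrite commutator_assoc_op /assoc_op.
rewrite (bilinearDl r_bilinear) (bilinearNl r_bilinear).
rewrite (bilinearDr l_bilinear) (bilinearNr l_bilinear) !r_sum !l_sum.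
vector_ring.
Qed.

(** The four terms of [assoc_op_commutatorl] are the orderings [x y z] and
    [z x y] with opposite signs, and [y x z] and [z y x] with opposite signs;
    each pair is related by a cyclic shift, so the cyclic sum vanishes. *)
Lemma assoc_op_cyclic x y z : [x, y] ** z + [y, z] ** x + [z, x] ** y = 0.
Proof. rewrite !assoc_op_commutatorl; vector_ring. Qed.

Lemma assoc_op_commutatorr x y z :
  z ** [x, y]
  = - (l (l x y) z - l (l y x) z - l (l z x) y + l (l z y) x)
    - (l (r x y) z - l (r y x) z - l (r z x) y + l (r z y) x).
Proof.
rewrite commutator_assoc_op /assoc_op /sum_op !rE !lE !rr_ll -!lr.
vector_ring.
Qed.

Hypothesis rl_lr : forall x y z, r (l x y) z = l x (r y z).

(** The sign axioms and [rr_ll] make [r (r x y) z + r (l x y) z] and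
    [l x (r y z) + l x (l y z)] the same multiple of [l (l x y) z], and
    [rl_lr] cancels the two inner terms. *)
Lemma rr_left_eq_ll_right x y z : r (r x y) z = l x (l y z).
Proof.
have : e *: r (sum_op r l x y) z = e *: l x (sum_op r l y z).
  by rewrite -rr -ll.
move=> /(congr1 ( *:%R e)); rewrite !scalerA -expr2 e_sign !scale1r.
rewrite /sum_op (bilinearDl r_bilinear) (bilinearDr l_bilinear) rl_lr addrC.
exact: addrI.
Qed.

Lemma assoc_op_right_defect x y z :
  (z ** y) ** x - (z ** x) ** y
  = l x (l y z) - l y (l x z) - l z (l x y) + l z (l y x).
Proof.
rewrite /assoc_op !rE !lE !rr_left_eq_ll_right !rl_lr; vector_ring.
Qed.

(** By the three expansions above, the left-hand side is the combination of the
    relation at the four orderings [x y z], [y x z], [z x y], [z y x] with signs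
    [+], [-], [-], [+]. *)
Lemma assoc_op_identity (a b c : F) :
    (forall x y z, (e * a - b) *: l (l x y) z - b *: l (r x y) z
       + c *: l x (l y z) = 0) ->
  forall x y z, a *: ([x, y] ** z) + b *: (z ** [x, y])
    + c *: ((z ** y) ** x - (z ** x) ** y) = 0.
Proof.
move=> rel x y z.
rewrite assoc_op_commutatorl assoc_op_commutatorr assoc_op_right_defect.
pose rel3 u v w := (e * a - b) *: l (l u v) w - b *: l (r u v) w
  + c *: l u (l v w).
have rel3_eq0 u v w : rel3 u v w = 0 by exact: rel.
transitivity (rel3 x y z - rel3 y x z - rel3 z x y + rel3 z y x).
  rewrite /rel3; vector_ring.
by rewrite !rel3_eq0 !subr0 addr0.
Qed.

End AssociatedProduct.

(** * Dendriform and anti-dendriform algebras *)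

Section Instances.

Variables (F : fieldType) (A : vectType F) (r l : A -> A -> A).

Lemma dendriform_signed : dendriform r l -> signed_dendriform 1 r l.
Proof.
by case=> r_bil l_bil rr ll lr; split=> // x y z; rewrite ?scale1r ?rr ?ll.
Qed.

Lemma anti_dendriform_signed :
  anti_dendriform r l -> signed_dendriform (-1) r l.
Proof.
by case=> r_bil l_bil rr rl ll lr; split=> // x y z; rewrite scaleN1r ?rr -?ll.
Qed.

Lemma anti_dendriform_rr_ll : anti_dendriform r l ->
  forall x y z, r x (r y z) = l (l x y) z.
Proof. by case=> _ _ rr rl ll _ x y z; rewrite rr rl ll. Qed.

Lemma dendriform_pre_lie : dendriform r l -> pre_lie (assoc_op r l).
Proof.
move=> /dendriform_signed rl_dend.
split=> [|x y z]; first exact: assoc_op_bilinear rl_dend.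
have := assoc_op_left_symmetric rl_dend x y z.
rewrite /commutator scale1r (bilinearDl (assoc_op_bilinear rl_dend)).
rewrite (bilinearNl (assoc_op_bilinear rl_dend)) => /eqP.
by rewrite subr_eq => /eqP ->; vector_ring.
Qed.

Lemma anti_dendriform_assoc_op : anti_dendriform r l ->
  forall x y z, assoc_op r l x (assoc_op r l y z)
      - assoc_op r l y (assoc_op r l x z)
    = assoc_op r l (commutator (assoc_op r l) y x) z.
Proof.
move=> /anti_dendriform_signed rl_dend x y z.
rewrite (assoc_op_left_symmetric rl_dend) scaleN1r.
by rewrite -(bilinearNl (assoc_op_bilinear rl_dend)) /commutator opprB.
Qed.

Lemma anti_dendriform_anti_pre_lie :
  anti_dendriform r l -> anti_pre_lie (assoc_op r l).
Proof.
move=> rl_anti; have rl_dend := anti_dendriform_signed rl_anti.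
split; first exact: assoc_op_bilinear rl_dend.
  exact: anti_dendriform_assoc_op.
apply: assoc_op_cyclic rl_dend _ _; first by rewrite sqrrN expr1n.
exact: anti_dendriform_rr_ll.
Qed.

End Instances.

Theorem corollary3p21 (F : fieldType) (char0 : [pchar F] =i pred0)
    (A : vectType F) :
  ((forall (q : F) (q_neq0 : q != 0) (q_neq1 : q != 1) (q_neqN1 : q != -1)
       (succ prec : A -> A -> A),
     dendriform succ prec ->
     (forall x y z, succ x (succ y z) = prec (prec x y) z) ->
     (forall x y z, succ (prec x y) z = prec x (succ y z)) ->
     (forall x y z,
       (q ^+ 2 + 3%:R * q + 2%:R) *: prec (prec x y) z
       + (q ^+ 2 + 2%:R * q) *: succ x (prec y z)
       + (q ^+ 2 - q) *: prec x (prec y z) = 0) ->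
     let ast := assoc_op succ prec in
     pre_lie ast /\
     (forall x y z,
       (2%:R + q) *: ast (commutator ast x y) z
       + (- q ^+ 2 - 2%:R * q) *: ast z (commutator ast x y)
       + (q ^+ 2 - q) *: (ast (ast z y) x - ast (ast z x) y) = 0))
   /\
   (forall succ prec : A -> A -> A,
     novikov_dendriform succ prec -> novikov (assoc_op succ prec)))
  /\
  ((forall (q : F) (q_neq0 : q != 0) (q_neq1 : q != 1) (q_neqN1 : q != -1)
       (tr tl : A -> A -> A),
     anti_dendriform tr tl ->
     (forall x y z, tr (tl x y) z = tl x (tr y z)) ->
     (forall x y z,
       (- q ^+ 2 + q + 2%:R) *: tl (tl x y) z
       - q ^+ 2 *: tl (tr x y) z
       + (q ^+ 2 + q) *: tl x (tl y z) = 0) ->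
     let circ := assoc_op tr tl in
     anti_pre_lie circ /\
     (forall x y z,
       (2%:R + q) *: circ (commutator circ x y) z
       - q ^+ 2 *: circ z (commutator circ x y)
       + (q ^+ 2 + q) *: (circ (circ z x) y - circ (circ z y) x) = 0))
   /\
   (forall tr tl : A -> A -> A,
     admissible_novikov_dendriform tr tl ->
     admissible_novikov (assoc_op tr tl))).
Proof.
have sqrN1 : (-1) ^+ 2 = 1 :> F by rewrite sqrrN expr1n.
have sqr1 : 1 ^+ 2 = 1 :> F by rewrite expr1n.
split; split.
- move=> q _ _ _ succ prec dend rr_ll rl_lr rel ast.
  split; first exact: dendriform_pre_lie.
  have identity := assoc_op_identity (dendriform_signed dend) sqr1 rr_ll rl_lr.
  apply: identity => x y z.
  rewrite -(rel x y z) (dend_succ_prec dend); vector_ring.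
- move=> succ prec [dend rr_ll rl_lr ll0].
  split=> [|x y z]; first exact: dendriform_pre_lie.
  have := assoc_op_identity (a := 0) (b := 0) (c := 1)
    (dendriform_signed dend) sqr1 rr_ll rl_lr.
  move=> /(_ _ z y x); rewrite !scale0r scale1r !add0r => identity.
  apply/subr0_eq/identity => u v w.
  by rewrite ll0 mulr0 subrr !scale0r scaler0 subrr addr0.
- move=> q _ _ _ tr tl anti rl_lr rel circ.
  split=> [|x y z]; first exact: anti_dendriform_anti_pre_lie.
  have := assoc_op_identity
    (a := 2%:R + q) (b := - q ^+ 2) (c := - (q ^+ 2 + q))
    (anti_dendriform_signed anti) sqrN1 (anti_dendriform_rr_ll anti) rl_lr.
  move=> /(_ _ x y z) <- => [|u v w]; first by rewrite /circ; vector_ring.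
  rewrite -[RHS]oppr0 -(rel u v w); vector_ring.
- move=> tr tl [anti rl_lr ll].
  have rl_dend := anti_dendriform_signed anti.
  split=> [||x y z]; first exact: assoc_op_bilinear rl_dend.
    exact: anti_dendriform_assoc_op.
  have := assoc_op_identity (a := 0) (b := 2%:R) (c := 1)
    rl_dend sqrN1 (anti_dendriform_rr_ll anti) rl_lr.
  move=> /(_ _ y z x) identity; apply/subr0_eq.
  rewrite -[RHS]identity => [|u v w]; first vector_ring.
  rewrite ll /sum_op (bilinearDl (adend_bilinear_tl anti)); vector_ring.
Qed.
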